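(* Let $f=1_{[0,1]}$ and let $\gamma<1$ (with $\gamma>0$). For each $n$, let $N$ be a Poisson process on $\mathbb{R}$ with intensity $nf$ with respect to Lebesgue measure. Then there exist $\delta<1$ and a constant $c>0$, both independent of $n$, such that for all $n$ large enough $$\mathbb{E}\big(\|\tilde f^H_{n,\gamma}-f\|_2^2\big)\ge\frac{c}{n^\delta}.$$
   Context: Haar basis: $\phi=1_{[0,1]}$, $\psi=1_{[0,1/2]}-1_{(1/2,1]}$, $\phi_k(x)=\phi(x-k)$, $\psi_{j,k}(x)=2^{j/2}\psi(2^jx-k)$ ($j\ge0$, $k\in\mathbb{Z}$). $\Lambda=\{(j,k):j\ge-1,k\in\mathbb{Z}\}$; $\varphi_\lambda=\phi_k$ if $\lambda=(-1,k)$ and $\varphi_\lambda=\psi_{j,k}$ if $\lambda=(j,k)$, $j\ge0$. Define $\hat\beta_\lambda=\frac1n\sum_{T\in N}\varphi_\lambda(T)$, $\hat V_{\lambda,n}=\frac1{n^2}\sum_{T\in N}\varphi_\lambda^2(T)$, $$\tilde V_{\lambda,n}=\hat V_{\lambda,n}+\sqrt{2\gamma\ln n\,\hat V_{\lambda,n}\frac{\|\varphi_\lambda\|_\infty^2}{n^2}}+3\gamma\ln n\frac{\|\varphi_\lambda\|_\infty^2}{n^2},\qquad \eta_{\lambda,\gamma}=\sqrt{2\gamma\tilde V_{\lambda,n}\ln n}+\frac{\gamma\ln n}{3n}\|\varphi_\lambda\|_\infty.$$ Let $j_0$ be the integer with $2^{j_0}\le n<2^{j_0+1}$ and $\Gamma_n=\{(j,k)\in\Lambda: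 j\le j_0\}$. The estimator is $\tilde f^H_{n,\gamma}=\sum_{\lambda\in\Gamma_n}\hat\beta_\lambda 1_{\{|\hat\beta_\lambda|\ge\eta_{\lambda,\gamma}\}}\varphi_\lambda$. *)

(* Defs.v *)
From HB Require Import structures.
From mathcomp Require Import all_boot all_order all_algebra.
From mathcomp Require Import all_classical all_reals all_analysis.
Set Implicit Arguments. Unset Strict Implicit. Unset Printing Implicit Defensive.
Import Order.TTheory GRing.Theory Num.Theory.
Local Open Scope classical_set_scope.
Local Open Scope ring_scope.

Section Haar.
Variable R : realType.

(* phi = 1_[0,1] ; this is also the density f of the statement *)
Definition haar_phi (x : R) : R := if (0 <= x) && (x <= 1) then 1 else 0.

Definition haar_psi (x : R) : R :=
  if (0 <= x) && (x <= 2^-1) then 1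
  else if (2^-1 < x) && (x <= 1) then -1 else 0.

(* varphi_lambda for lambda = (j,k); j = -1 (i.e. Negz 0) gives phi_k,
   j >= 0 gives psi_{j,k}.  Only indices with j >= -1 are ever used. *)
Definition haar (l : int * int) (x : R) : R :=
  match l.1 with
  | Posz j => Num.sqrt (2 ^+ j) * haar_psi (2 ^+ j * x - l.2%:~R)
  | Negz _ => haar_phi (x - l.2%:~R)
  end.

Definition supnorm (g : R -> R) : R := sup (range (fun x => `|g x|)).

Definition Lambda : set (int * int) := [set l | -1 <= l.1].
Definition Gamma_n (n : nat) : set (int * int) :=
  [set l | -1 <= l.1 /\ l.1 <= (trunc_log 2 n)%:Z].

(* the point configuration N is represented by the finite list of its points *)
Definition beta_hat (n : nat) (pts : seq R) (l : int * int) : R :=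
  n%:R^-1 * \sum_(t <- pts) haar l t.

Definition V_hat (n : nat) (pts : seq R) (l : int * int) : R :=
  (n%:R ^+ 2)^-1 * \sum_(t <- pts) (haar l t) ^+ 2.

Definition V_tilde (gamma : R) (n : nat) (pts : seq R) (l : int * int) : R :=
  V_hat n pts l
  + Num.sqrt (2 * gamma * ln n%:R * V_hat n pts l
              * (supnorm (haar l) ^+ 2 / n%:R ^+ 2))
  + 3 * gamma * ln n%:R * (supnorm (haar l) ^+ 2 / n%:R ^+ 2).

Definition eta (gamma : R) (n : nat) (pts : seq R) (l : int * int) : R :=
  Num.sqrt (2 * gamma * V_tilde gamma n pts l * ln n%:R)
  + gamma * ln n%:R / (3 * n%:R) * supnorm (haar l).

(* the hard-thresholding estimator tilde f^H_{n,gamma} (pointwise; for each x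
   only finitely many terms are non-zero) *)
Definition f_tilde_H (gamma : R) (n : nat) (pts : seq R) (x : R) : R :=
  \sum_(l \in Gamma_n n)
     (if eta gamma n pts l <= `|beta_hat n pts l| then beta_hat n pts l else 0)
     * haar l x.

Definition L2_loss (gamma : R) (n : nat) (pts : seq R) : \bar R :=
  (\int[lebesgue_measure]_x ((f_tilde_H gamma n pts x - haar_phi x) ^+ 2)%:E)%E.

Definition count_in (A : set R) (pts : seq R) : nat :=
  count (fun t => t \in A) pts.

Definition poisson_process d (T : measurableType d) (P : probability T R)
  (h : R -> R) (N : T -> seq R) : Prop :=
  (forall A, measurable A -> forall k : nat,
      measurable [set w | count_in A (N w) = k]) /\
  (forall A, measurable A -> forall k : nat,
      let m := fine (\int[lebesgue_measure]_(x in A) (h x)%:E)%E in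
      P [set w | count_in A (N w) = k] = (expR (- m) * m ^+ k / (k`!)%:R)%:E) /\
  (forall (p : nat) (A : 'I_p -> set R) (k : 'I_p -> nat),
      (forall i, measurable (A i)) ->
      (forall i j, i != j -> A i `&` A j = set0) ->
      fine (P (\bigcap_(i in [set: 'I_p]) [set w | count_in (A i) (N w) = k i]))
      = \prod_(i < p) fine (P [set w | count_in (A i) (N w) = k i])).

End Haar.

(* Main.v *)
From HB Require Import structures.
From mathcomp Require Import all_boot all_order all_algebra.
From mathcomp Require Import all_classical all_reals all_analysis.
From mathcomp Require Import measurable_realfun ring lra zify.
Require Import Defs.
Set Implicit Arguments. Unset Strict Implicit. Unset Printing Implicit Defensive.
Import Order.TTheory GRing.Theory Num.Theory.
Local Open Scope classical_set_scope.
Local Open Scope ring_scope.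

(* Write L = ln n.  At a level j with mu = n / 2^(j+1) of the order of L, the
   numbers of points in the two halves of a dyadic interval are independent
   Poisson(mu) variables.  With m = floor(mu) and s close to sqrt(gamma' L m)
   for some gamma' slightly above gamma, the event that they equal m + s and
   m - s makes the empirical coefficient pass its threshold.  Its probability
   is at least e^-4 m^-2 exp(- s^2 / (m - s)), hence at least n^-(1 - 2 th) up
   to powers of L, because gamma < 1.  All level-j coefficients of the density
   vanish, so by Parseval every coefficient that is kept contributes its square
   to the loss; summing over the 2^j intervals yields the rate n^-(1 - th). *)

(** * Lower bounds for Poisson probabilities near the mean *)

Section PoissonEstimates.
Variable R : realType.
Implicit Types (x mu g th eps L M r s : R) (m n k q : nat).

(** Since 1 / (1 - x) = 1 + y with y = x / (1 - x), taking inverses reduces it to 1 + y <= exp y. *)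
Lemma expR_le_inv1B x : x < 1 -> expR (- (x / (1 - x))) <= 1 - x.
Proof.
move=> x1; have x1' : 0 < 1 - x by rewrite subr_gt0.
rewrite expRN -[leRHS]invrK lef_pV2 ?posrE ?expR_gt0 ?invr_gt0//.
apply: le_trans (expR_ge1Dx _).
rewrite le_eqVlt; apply/orP; left; apply/eqP; field.
by rewrite gt_eqF.
Qed.

(** Stirling up to a factor of order sqrt m. The induction step needs e (m+1)^(m+2) <= (m+2)^(m+2),
    which is [h] raised to the power m+2. *)
Lemma factorial_le_expR m :
  (m.+1`!)%:R <= m.+1%:R ^+ m.+2 * expR (- m%:R) :> R.
Proof.
elim: m => [|m IH]; first by rewrite oppr0 expR0 mulr1 expr1n.
rewrite factS natrM.
apply: (le_trans (ler_wpM2l _ IH)); first exact: ler0n.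
rewrite [m.+2%:R ^+ m.+3]exprS -mulrA ler_wpM2l ?ler0n//.
have h : m.+1%:R * expR (m.+2%:R^-1) <= m.+2%:R :> R.
  rewrite -ler_pdivlMr ?expR_gt0// -expRN.
  have := expR_ge1Dx (- m.+2%:R^-1 : R).
  move=> /(ler_wpM2l (ler0n _ m.+2)); apply: le_trans.
  rewrite mulrDr mulr1 mulrN divff ?pnatr_eq0//.
  by rewrite -(natr1 m.+1) addrK.
have := lerXn2r m.+2 _ _ h.
rewrite !nnegrE mulr_ge0 ?expR_ge0 ?ler0n// => /(_ isT isT).
rewrite exprMn -expRM_natl mulfV ?pnatr_eq0// => h2.
have -> : - m.+1%:R = - m%:R + - 1 :> R by rewrite -natr1 opprD.
rewrite expRD.
rewrite [leRHS]mulrCA [leLHS]mulrC ler_wpM2l ?expR_ge0//.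
by rewrite [expR (- 1)]expRN ler_pdivlMr ?expR_gt0.
Qed.

(** With M = m+1 the integer part of mu, the factorial bound leaves exp (M - 1 - mu) / M, and mu < M
    + 1. *)
Lemma poisson_mode_ge m mu : m.+1%:R <= mu -> mu < m.+2%:R ->
  expR (- 2) / m.+1%:R <= expR (- mu) * mu ^+ m.+1 / (m.+1`!)%:R.
Proof.
move=> h1 h2.
rewrite ler_pdivlMr ?ltr0n ?fact_gt0//.
apply: (le_trans (ler_wpM2l _ (factorial_le_expR m))).
  by rewrite divr_ge0 ?expR_ge0.
rewrite exprS.
have -> : expR (- 2) / m.+1%:R * (m.+1%:R * m.+1%:R ^+ m.+1 * expR (- m%:R))
  = expR (- 2 - m%:R) * m.+1%:R ^+ m.+1 :> R.
  have : m.+1%:R != 0 :> R by rewrite pnatr_eq0.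
  by rewrite expRD; move: (m.+1%:R : R) => y y0; field.
apply: ler_pM; rewrite ?expR_ge0 ?exprn_ge0//.
- by rewrite ler_expR; move: h2; rewrite -2!natr1; lra.
- by apply: lerXn2r => //; rewrite nnegrE// (le_trans _ h1).
Qed.

(** Passing from q to q+1 multiplies the left side by (m+q+1)(1 - k/m) and the right side by
    m-k+q+1, which is at least as large because k <= (m+q+1) k/m. At q = k it compares (m+k)! (m-k)!
    with the square of m!. *)
Lemma factorial_pair_le m k q : (k <= m)%N -> (0 < m)%N ->
  ((m + q)`!)%:R * ((m - k)`!)%:R * (1 - k%:R / m%:R) ^+ q
  <= (m`!)%:R * ((m - k + q)`!)%:R :> R.
Proof.
move=> km m0; have m0' : 0 < m%:R :> R by rewrite ltr0n.
have k0 : 0 <= 1 - k%:R / m%:R :> R.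
  by rewrite subr_ge0 ler_pdivrMr// mul1r ler_nat.
elim: q => [|q IH]; first by rewrite !addn0 mulr1.
rewrite !addnS !factS !natrM exprS.
have step : (m + q).+1%:R * (1 - k%:R / m%:R) <= (m - k + q).+1%:R :> R.
  rewrite -!natr1 !natrD natrB//.
  rewrite mulrBr mulr1 -!addrA lerD2l.
  have : k%:R <= (m%:R + q%:R + 1) * (k%:R / m%:R) :> R.
    rewrite mulrA ler_pdivlMr// mulrC ler_wpM2r//.
    by rewrite -addrA lerDl addr_ge0.
  lra.
rewrite (_ : _ * _ * _ = (m + q).+1%:R * (1 - k%:R / m%:R) *
  (((m + q)`!)%:R * ((m - k)`!)%:R * (1 - k%:R / m%:R) ^+ q)); last by ring.
rewrite [leRHS]mulrCA.
by apply: ler_pM; rewrite ?mulr_ge0 ?exprn_ge0.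
Qed.

(** The product is the squared mass at m times m!^2 / ((m+k)! (m-k)!). The first factor is bounded
    at the mode; the second is at least (1 - k/m)^k, which [expR_le_inv1B] at k/m makes
    exponential. *)
Lemma poisson_pair_ge m k mu : (k < m)%N -> m%:R <= mu -> mu < m.+1%:R ->
  expR (- 4) / m%:R ^+ 2 * expR (- (k%:R ^+ 2 / (m%:R - k%:R)))
  <= (expR (- mu) * mu ^+ (m + k) / ((m + k)`!)%:R) *
     (expR (- mu) * mu ^+ (m - k) / ((m - k)`!)%:R).
Proof.
case: m => [//|m] km h1 h2.
have mu0 : 0 < mu by apply: lt_le_trans h1; rewrite ltr0n.
have km' : 0 < m.+1%:R - k%:R :> R by rewrite subr_gt0 ltr_nat.
have md := poisson_mode_ge h1 h2.
have pw : expR (- (k%:R ^+ 2 / (m.+1%:R - k%:R)))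
          <= (1 - k%:R / m.+1%:R) ^+ k :> R.
  have -> : - (k%:R ^+ 2 / (m.+1%:R - k%:R)) =
     k%:R * - ((k%:R / m.+1%:R) / (1 - k%:R / m.+1%:R)) :> R.
    have : m.+1%:R != 0 :> R by rewrite pnatr_eq0.
    move: km'; move: (m.+1%:R : R) => y km' y0; field.
    by rewrite y0 gt_eqF.
  rewrite expRM_natl; apply: lerXn2r; rewrite ?nnegrE ?expR_ge0//.
    by rewrite subr_ge0 ler_pdivrMr ?ltr0n// mul1r ler_nat ltnW.
  by apply: expR_le_inv1B; rewrite ltr_pdivrMr ?ltr0n// mul1r ltr_nat.
have fp := factorial_pair_le k (ltnW km) (ltn0Sn m).
rewrite subnK ?(ltnW km)// in fp.
set a := (_`!)%:R in md fp; set b := (_`!)%:R in fp; set c := (_`!)%:R in fp.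
have a0 : 0 < a by rewrite ltr0n fact_gt0.
have b0 : 0 < b by rewrite ltr0n fact_gt0.
have c0 : 0 < c by rewrite ltr0n fact_gt0.
rewrite -/b -/c.
have -> : expR (- mu) * mu ^+ (m.+1 + k) / b * (expR (- mu) * mu ^+ (m.+1 - k) / c)
  = (expR (- mu) * mu ^+ m.+1 / a) ^+ 2 * (a * a / (b * c)).
  have e : mu ^+ (m.+1 + k) * mu ^+ (m.+1 - k) = (mu ^+ m.+1) ^+ 2.
    by rewrite -exprD -exprM; congr (_ ^+ _); lia.
  rewrite exprMn exprMn -e; field.
  by rewrite !gt_eqF.
apply: ler_pM; rewrite ?expR_ge0 ?divr_ge0 ?exprn_ge0 ?expR_ge0//.
- rewrite (_ : _ / _ = (expR (- 2) / m.+1%:R) ^+ 2).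
    apply: lerXn2r => //; rewrite nnegrE.
    + by rewrite divr_ge0 ?expR_ge0.
    + by rewrite divr_ge0 ?mulr_ge0 ?exprn_ge0 ?expR_ge0// ltW.
  rewrite expr_div_n -expRM_natl; congr (expR _ / _); lra.
- apply: (le_trans pw).
  rewrite ler_pdivlMr ?mulr_gt0//.
  by rewrite mulrC.
Qed.

(** * Size of the deviation that passes the threshold *)

Section Threshold.
(** Here g stands for sqrt gamma, L for ln n, M for the integer part of the mean count, s for the
    deviation from it, and th for a quarter of the gap 1 - g. *)
Variables (g th eps L M r s : R).
Hypotheses (g0 : 0 <= g) (th0 : 0 < th) (gth : g + 4 * th = 1).
Hypotheses (epsE : eps = th ^+ 2 / 10).
Hypotheses (L1 : 1 <= L) (LM : L <= eps ^+ 2 * M).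
Hypotheses (r0 : 0 <= r) (rE : r ^+ 2 = L * M).
Hypotheses (s_gt : (g + th) * r < s) (s_le : s <= (g + th) * r + 1).

Let eps0 : 0 < eps.
Proof. by rewrite epsE divr_gt0// exprn_gt0. Qed.

Let M0 : 0 < M.
Proof.
have := lt_le_trans (lt_le_trans ltr01 L1) LM.
by rewrite pmulr_rgt0// exprn_gt0.
Qed.

Let th_le : th <= 1 / 4. Proof. by have := g0; have := gth; lra. Qed.

Let eps_le : eps <= th / 10.
Proof.
rewrite epsE ler_wpM2r// expr2 ler_piMl//; first exact: ltW.
by have := th_le; lra.
Qed.

(** As r is the geometric mean of L and M, the hypothesis [LM] splits into two equal steps: L <= eps
    r and r <= eps M. *)
Let Lr : L <= eps * r.
Proof.
rewrite -(ler_pXn2r (n := 2))// ?nnegrE; last 2 first.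
  by apply: le_trans L1.
  by rewrite mulr_ge0// ltW.
rewrite exprMn rE.
rewrite expr2 mulrCA ler_wpM2l//; exact: le_trans L1.
Qed.

Let rM : r <= eps * M.
Proof.
rewrite -(ler_pXn2r (n := 2))// ?nnegrE; last by rewrite mulr_ge0// ltW.
rewrite exprMn rE [M ^+ 2]expr2 mulrA ler_wpM2r//; exact: ltW.
Qed.

Lemma threshold_deviation_ge1 : 1 <= (g + th) * r.
Proof.
have h : 1 <= eps * r by apply: le_trans Lr.
have : eps * r <= (g + th) * r.
  apply: ler_wpM2r => //; have := eps_le; have := g0; have := th0; lra.
lra.
Qed.

Lemma threshold_deviation_lt : s < M.
Proof.
have := threshold_deviation_ge1; have := rM; have := eps_le.
have := th_le; have := gth; have := th0; have := g0; have := r0; have := M0; have := s_le => *.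
have : (g + th) * r <= r by rewrite ler_piMl//; lra.
have : eps * M <= M / 40 by rewrite mulrC ler_wpM2l//; lra.
lra.
Qed.

(** This is the retention test for the counts M + s and M - s, with sum 2M and difference 2s, at
    gamma = g^2. The main term is sqrt (4 g^2 L M) = 2 g r; all other terms cost at most 2 th r, and
    s exceeds (g + th) r. *)
Lemma threshold_deviation_le :
  Num.sqrt (2 * g ^+ 2 * (2 * M + Num.sqrt (2 * g ^+ 2 * L * (2 * M))
     + 3 * g ^+ 2 * L) * L) + g ^+ 2 * L / 3 <= 2 * s.
Proof.
have L0 : 0 <= L by apply: le_trans L1.
have g1 : g <= 1 by have := gth; have := th0; lra.
have -> : 2 * g ^+ 2 * L * (2 * M) = (2 * g * r) ^+ 2.
  by rewrite !exprMn rE; ring.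
rewrite sqrtr_sqr ger0_norm; last by rewrite !mulr_ge0.
have g21 : g ^+ 2 <= 1 by rewrite expr_le1.
have g20 : 0 <= g ^+ 2 by rewrite exprn_ge0.
have h1 : Num.sqrt (2 * g ^+ 2 * (2 * M + 2 * g * r + 3 * g ^+ 2 * L) * L)
    <= (2 * g + th) * r.
  have h0 : 0 <= (2 * g + th) * r.
    by rewrite mulr_ge0// addr_ge0 ?mulr_ge0// ltW.
  rewrite -[leRHS]ger0_norm// -sqrtr_sqr ler_wsqrtr//.
  have -> : 2 * g ^+ 2 * (2 * M + 2 * g * r + 3 * g ^+ 2 * L) * L =
    4 * g ^+ 2 * r ^+ 2 + (4 * (g ^+ 2 * g)) * (L * r) + 6 * (g ^+ 2 * g ^+ 2) * L ^+ 2.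
    by rewrite rE; ring.
  have e1 : L * r <= eps * r ^+ 2 by rewrite expr2 mulrA ler_wpM2r.
  have e2 : L ^+ 2 <= eps * r ^+ 2.
    apply: le_trans e1; rewrite expr2 ler_wpM2l//; apply: (le_trans Lr).
    by rewrite ler_piMl//; have := eps_le; have := th_le; lra.
  have e3 : 4 * (g ^+ 2 * g) * (L * r) <= 4 * (eps * r ^+ 2).
    rewrite -mulrA ler_pM2l// -[leRHS]mul1r ler_pM ?mulr_ge0//.
    by rewrite mulr_ile1.
  have e4 : 6 * (g ^+ 2 * g ^+ 2) * L ^+ 2 <= 6 * (eps * r ^+ 2).
    rewrite -mulrA ler_pM2l// -[leRHS]mul1r ler_pM ?mulr_ge0 ?exprn_ge0//.
    by rewrite mulr_ile1.
  (* The 10 in [eps] is the 4 + 6 of [e3] and [e4]: together the corrections fit into (th r)^2. *)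
  have e5 : 10 * (eps * r ^+ 2) = (th * r) ^+ 2.
    by rewrite epsE exprMn; field.
  have e6 : ((2 * g + th) * r) ^+ 2 = 4 * g ^+ 2 * r ^+ 2 + 4 * g * th * r ^+ 2 + (th * r) ^+ 2.
    by ring.
  have e7 : 0 <= 4 * g * th * r ^+ 2.
    by rewrite !mulr_ge0 ?exprn_ge0// ltW.
  rewrite e6; lra.
have h2 : g ^+ 2 * L / 3 <= th * r.
  have : g ^+ 2 * L <= 1 * (eps * r) by apply: ler_pM.
  have : eps * r <= (th / 10) * r by apply: ler_wpM2r.
  have : 0 <= th * r by rewrite mulr_ge0// ltW.
  lra.
have := s_gt; lra.
Qed.

(** Rounding costs at most th r, so s <= (g + 2 th) r = (1 - 2 th) r. Since also M - s >= (1 - 2 th)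
    M, one of the two factors 1 - 2 th in s^2 cancels. *)
Lemma threshold_exponent_le : s ^+ 2 / (M - s) <= (1 - 2 * th) * L.
Proof.
have L0 : 0 <= L by apply: le_trans L1.
have sM := threshold_deviation_lt.
rewrite ler_pdivrMr ?subr_gt0//.
have hr : 1 <= eps * r by apply: le_trans Lr.
have d1 := threshold_deviation_ge1.
have eps_th : eps <= th by have := eps_le; have := th0; lra.
have er : eps * r <= th * r by apply: ler_wpM2r.
have s1 : s <= (1 - 2 * th) * r.
  apply: (le_trans s_le).
  rewrite (_ : 1 - 2 * th = g + th + th); first by rewrite mulrDl; lra.
  by have := gth; lra.
have s0 : 0 <= s by have := s_gt; lra.
have a0 : 0 <= 1 - 2 * th by have := th_le; lra.
have t1 : s ^+ 2 <= (1 - 2 * th) ^+ 2 * (L * M).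
  by rewrite -rE -exprMn; apply: lerXn2r; rewrite ?nnegrE ?mulr_ge0.
have t2 : s <= 2 * th * M.
  have : s <= r by apply: (le_trans s1); rewrite ler_piMl//; have := th0; lra.
  have : eps * M <= th * M by apply: ler_wpM2r => //; exact: ltW.
  have : 0 < th * M by rewrite mulr_gt0.
  have := rM; lra.
apply: (le_trans t1).
rewrite expr2 -!mulrA ler_wpM2l// mulrCA ler_wpM2l//.
lra.
Qed.

End Threshold.
End PoissonEstimates.

(** * Orthonormality of the Haar system and Parseval's identity *)

Section HaarSystem.
Variable R : realType.
Implicit Types (x y u v : R) (f h : R -> R) (j k n J : nat) (l : int * int).

Local Notation mu := (@lebesgue_measure R).

(** Integrability travels with the value, so that linear combinations compose without side
    conditions. *)
Definition has_integral (f : R -> R) (v : R) : Prop :=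
  mu.-integrable setT (fun x => (f x)%:E) /\
  (\int[mu]_x (f x)%:E = v%:E)%E.

Lemma eq_has_integral f h u v :
  (forall x, f x = h x) -> u = v -> has_integral f u -> has_integral h v.
Proof. by move=> /funext -> ->. Qed.

Lemma has_integral_indic u v : u <= v -> has_integral \1_(`]u, v]) (v - u).
Proof.
move=> uv; split.
  exact: integrable_indic_itv.
rewrite integral_indic// setIT [LHS](lebesgue_measure_itv `]u, v])/= lte_fin.
by case: ltP => // vu; rewrite (le_anti (introT andP (conj uv vu))) subrr.
Qed.

Lemma has_integralZ f u v : has_integral f u -> has_integral (fun x => v * f x) (v * u).
Proof.
move=> [fi fE]; split.
  by under eq_fun do rewrite EFinM; exact: integrableZl.
under eq_integral do rewrite EFinM.
by rewrite integralZl// fE.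
Qed.

Lemma has_integralD f h u v : has_integral f u -> has_integral h v ->
  has_integral (fun x => f x + h x) (u + v).
Proof.
move=> [fi fE] [hi hE]; split.
  by under eq_fun do rewrite EFinD; exact: integrableD.
under eq_integral do rewrite EFinD.
by rewrite integralD// fE hE.
Qed.

Lemma has_integral_sum (I : eqType) (s : seq I) (F : I -> R -> R) (G : I -> R) :
  (forall i, i \in s -> has_integral (F i) (G i)) ->
  has_integral (fun x => \sum_(i <- s) F i x) (\sum_(i <- s) G i).
Proof.
elim: s => [_|i s IH FG].
  split; [under eq_fun do rewrite big_nil; exact: integrable0|].
  under eq_integral do rewrite big_nil.
  by rewrite integral0 big_nil.
rewrite big_cons; apply: (eq_has_integral _ erefl); last first.
  apply: has_integralD; first by apply: FG; rewrite mem_head.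
  by apply: IH => a si; apply: FG; rewrite inE si orbT.
by move=> x; rewrite big_cons.
Qed.

(* Half-open variants of the Haar functions: they differ from the closed ones
   at a single dyadic point only, and with them the nesting of the dyadic
   intervals holds exactly instead of almost everywhere. *)
Definition phi_half_open x : R := if x <= 0 then 0 else if x <= 1 then 1 else 0.

Definition psi_half_open x : R :=
  if x <= 0 then 0 else if x <= 2^-1 then 1 else if x <= 1 then -1 else 0.

Definition haar_half_open l x : R :=
  match l.1 with
  | Posz j => Num.sqrt (2 ^+ j) * psi_half_open (2 ^+ j * x - l.2%:~R)
  | Negz _ => phi_half_open (x - l.2%:~R)
  end.

Lemma pow2_gt0 j : 0 < 2 ^+ j :> R. Proof. by rewrite exprn_gt0. Qed.

(** The two versions can disagree only where the rescaled argument is 0, that is at a dyadic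
    rational; irrationality of x excludes this for all indices at once. *)
Lemma haar_half_openE l x : (forall q : rat, x != ratr q) ->
  haar_half_open l x = haar l x.
Proof.
move=> xq; case: l => -[j|j] k; rewrite /haar_half_open/haar/=.
  have : 2 ^+ j * x - k%:~R != 0.
    rewrite subr_eq0; apply: contra_neq (xq (k%:~R / 2 ^+ j)) => e.
    rewrite rmorphM/= fmorphV rmorphXn/= rmorph_nat rmorph_int -e.
    by rewrite mulrC mulKf// gt_eqF// pow2_gt0.
  move: (2 ^+ j * x - _) => z z0; congr (_ * _).
  rewrite /psi_half_open/haar_psi; move: z0; case: (ltgtP z 0) => //= ? _;
    by case: (leP z (2^-1)) => ? //=; case: (leP z 1) => ? //=; lra.
have : x - k%:~R != 0.
  by rewrite subr_eq0; have := xq k%:~R; rewrite rmorph_int.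
move: (x - _) => z z0.
by rewrite /phi_half_open/haar_phi; move: z0; case: (ltgtP z 0).
Qed.

Lemma indic_itvE u v x : \1_(`]u, v]) x = (if x <= u then 0 else if x <= v then 1 else 0) :> R.
Proof.
rewrite indicE mem_setE in_itv/=.
by case: (leP x u) => //=; case: (leP x v).
Qed.

Lemma dyadic_leE j x a b : (2 ^+ j * x - a <= b) = (x <= (a + b) / 2 ^+ j).
Proof. by rewrite ler_pdivlMr ?pow2_gt0// lerBlDl mulrC. Qed.

Lemma psi_half_open_indic j x a : psi_half_open (2 ^+ j * x - a) =
  \1_(`](a / 2 ^+ j), ((a + 2^-1) / 2 ^+ j)]) x
  - \1_(`]((a + 2^-1) / 2 ^+ j), ((a + 1) / 2 ^+ j)]) x.
Proof.
rewrite /psi_half_open !dyadic_leE !indic_itvE addr0.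
have h1 : a / 2 ^+ j <= (a + 2^-1) / 2 ^+ j.
  by rewrite ler_wpM2r ?invr_ge0 ?exprn_ge0//; lra.
have h2 : (a + 2^-1) / 2 ^+ j <= (a + 1) / 2 ^+ j.
  by rewrite ler_wpM2r ?invr_ge0 ?exprn_ge0//; lra.
case: (leP x (a / 2 ^+ j)) => ha.
  by rewrite (le_trans ha h1) subr0.
case: (leP x ((a + 2^-1) / 2 ^+ j)) => hb; first by rewrite subr0.
by case: ifP; rewrite sub0r ?oppr0.
Qed.

Lemma has_integral_haar j (k : int) :
  has_integral (haar_half_open (Posz j, k)) 0.
Proof.
have p0 := pow2_gt0 j.
apply: (eq_has_integral (f := fun x => Num.sqrt (2 ^+ j) * (
  \1_(`](k%:~R / 2 ^+ j), ((k%:~R + 2^-1) / 2 ^+ j)]) x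
  + (-1) * \1_(`]((k%:~R + 2^-1) / 2 ^+ j), ((k%:~R + 1) / 2 ^+ j)]) x))); last first.
- apply: has_integralZ; apply: has_integralD.
    by apply: has_integral_indic; rewrite ler_wpM2r ?invr_ge0 ?exprn_ge0//; lra.
  apply: has_integralZ.
  by apply: has_integral_indic; rewrite ler_wpM2r ?invr_ge0 ?exprn_ge0//; lra.
- by field; rewrite gt_eqF.
- by move=> x; rewrite mulN1r -psi_half_open_indic.
Qed.

Lemma has_integral_haar_sqr j (k : int) :
  has_integral (fun x => haar_half_open (Posz j, k) x * haar_half_open (Posz j, k) x) 1.
Proof.
have p0 := pow2_gt0 j.
apply: (eq_has_integral (f := fun x => 2 ^+ j *
  \1_(`](k%:~R / 2 ^+ j), ((k%:~R + 1) / 2 ^+ j)]) x)); last first.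
- apply: has_integralZ; apply: has_integral_indic.
  by rewrite ler_wpM2r ?invr_ge0 ?exprn_ge0//; lra.
- by field; rewrite gt_eqF.
- move=> x; rewrite /haar_half_open/= mulrACA -expr2 sqr_sqrtr ?exprn_ge0//.
  congr (_ * _); rewrite indic_itvE -{1}[k%:~R]addr0 -!dyadic_leE /psi_half_open.
  move: (2 ^+ j * x - _) => z.
  by case: (leP z 0) => ?; case: (leP z (2^-1)) => ?; case: (leP z 1) => ?;
    rewrite ?mulr0 ?mulr1 ?mulrNN ?mulr1//; lra.
Qed.

Lemma has_integral_phi_sqr :
  has_integral (fun x => haar_half_open (Negz 0, 0) x * haar_half_open (Negz 0, 0) x) 1.
Proof.
apply: (eq_has_integral (f := \1_(`]0, 1]))); last first.
- exact: has_integral_indic.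
- by rewrite subr0.
- move=> x; rewrite indic_itvE /haar_half_open/= subr0 /phi_half_open.
  by case: (leP x 0); case: (leP x 1); rewrite ?mulr0 ?mulr1.
Qed.

Lemma psi_half_open_neq0 x : psi_half_open x != 0 -> (0 < x) && (x <= 1).
Proof.
rewrite /psi_half_open; case: (leP x 0); rewrite ?eqxx//= => ?.
by case: (leP x (2^-1)) => ?; case: (leP x 1) => ?; rewrite ?eqxx//; lra.
Qed.

Lemma haar_half_open_supp j (k : int) x : haar_half_open (Posz j, k) x != 0 ->
  (k%:~R < 2 ^+ j * x) && (2 ^+ j * x <= (k + 1)%:~R).
Proof.
rewrite /haar_half_open/= mulf_eq0 negb_or => /andP[_ /psi_half_open_neq0].
by rewrite subr_gt0 lerBlDl intrD.
Qed.

(** The outcome does not depend on X: points of one cell compare alike with every integer, hence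
    with every breakpoint of a coarser level after rescaling. *)
Lemma le_int_between (X : R) (k i : int) : k%:~R < X -> X <= (k + 1)%:~R ->
  (X <= i%:~R) = (k + 1 <= i).
Proof.
move=> kX Xk; apply/idP/idP => [Xi|].
  by have := lt_le_trans kX Xi; rewrite ltr_int -lezD1.
by rewrite -(ler_int R); exact: le_trans.
Qed.

(* The dyadic breakpoints of a coarser Haar function are endpoints of the finer
   dyadic intervals, so it is constant on each of them. *)
Lemma haar_coarse_cst j d (k k' : int) x y :
  (k'%:~R < 2 ^+ (j + d.+1) * x) && (2 ^+ (j + d.+1) * x <= (k' + 1)%:~R) ->
  (k'%:~R < 2 ^+ (j + d.+1) * y) && (2 ^+ (j + d.+1) * y <= (k' + 1)%:~R) ->
  haar_half_open (Posz j, k) x = haar_half_open (Posz j, k) y.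
Proof.
move=> /andP[x1 x2] /andP[y1 y2]; rewrite /haar_half_open/=; congr (_ * _).
have cmp (i : int) : (2 ^+ j * x <= i%:~R / 2) = (2 ^+ j * y <= i%:~R / 2).
  have aux (z : R) : (2 ^+ j * z <= i%:~R / 2) = (2 ^+ (j + d.+1) * z <= (i * 2 ^+ d)%:~R).
    rewrite ler_pdivlMr// exprD exprS intrM rmorphXn/=.
    rewrite (_ : _ * (_ * _) * z = (2 ^+ j * z * 2) * 2 ^+ d); last by ring.
    by rewrite ler_pM2r// pow2_gt0.
  by rewrite !aux (le_int_between _ x1 x2) (le_int_between _ y1 y2).
have c0 : (2 ^+ j * x - k%:~R <= 0) = (2 ^+ j * y - k%:~R <= 0).
  have := cmp (2 * k); rewrite !subr_le0 intrM mulrAC mulfV// mul1r.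
  exact.
have c1 : (2 ^+ j * x - k%:~R <= 2^-1) = (2 ^+ j * y - k%:~R <= 2^-1).
  have := cmp (2 * k + 1); rewrite !lerBlDl intrD intrM mulrDl mul1r mulrAC mulfV// mul1r.
  exact.
have c2 : (2 ^+ j * x - k%:~R <= 1) = (2 ^+ j * y - k%:~R <= 1).
  have := cmp (2 * (k + 1)); rewrite !lerBlDl intrM mulrAC mulfV// mul1r intrD.
  exact.
by rewrite /psi_half_open c0 c1 c2.
Qed.

(** The indices of level below J whose functions live on [0,1]. Up to a null set, only these
    contribute to the estimator there, so the infinite [Gamma_n] can be replaced by a finite
    list. *)
Definition haar_index J : seq (int * int) :=
  (Negz 0, Posz 0) :: [seq (Posz j, Posz k) | j <- iota 0 J, k <- iota 0 (2 ^ j)].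

Lemma mem_haar_index J l : l \in haar_index J ->
  l = (Negz 0, Posz 0) \/ exists j k, [/\ l = (Posz j, Posz k), (j < J)%N & (k < 2 ^ j)%N].
Proof.
rewrite inE => /orP[/eqP->|]; first by left.
move=> /allpairsPdep[j [k]]; rewrite !mem_iota/= !add0n => -[jJ kj ->].
by right; exists j, k.
Qed.

Lemma haar_indexP J j k : (j < J)%N -> (k < 2 ^ j)%N -> (Posz j, Posz k) \in haar_index J.
Proof.
move=> jJ kj; rewrite inE; apply/orP; right; apply/allpairsPdep.
by exists j, k; rewrite !mem_iota !add0n.
Qed.

Lemma haar_index_uniq J : uniq (haar_index J).
Proof.
rewrite /haar_index cons_uniq; apply/andP; split.
  by apply/negP => /allpairsPdep[j [k]] [_ _].
apply: allpairs_uniq_dep => [|j _|]; rewrite ?iota_uniq//.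
by move=> [a b] [c d] _ _ /= [-> ->].
Qed.

Lemma haar_finer_orthogonal j d (k k' : int) : has_integral
  (fun x => haar_half_open (Posz j, k) x * haar_half_open (Posz (j + d.+1), k') x) 0.
Proof.
have p0 := pow2_gt0 (j + d.+1).
(* The right endpoint belongs to the half-open support of the finer function, so the coarser one can
   be frozen at its value in y; what remains has mean zero. *)
pose y : R := (k' + 1)%:~R / 2 ^+ (j + d.+1).
have yE : 2 ^+ (j + d.+1) * y = (k' + 1)%:~R.
  by rewrite /y mulrC divfK// gt_eqF.
apply: (eq_has_integral
  (f := fun x => haar_half_open (Posz j, k) y * haar_half_open (Posz (j + d.+1), k') x));
  last first.
- apply: has_integralZ; exact: has_integral_haar.
- by rewrite mulr0.
- move=> x; have [->|nz] := eqVneq (haar_half_open (Posz (j + d.+1), k') x) 0.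
    by rewrite !mulr0.
  congr (_ * _); apply: haar_coarse_cst (haar_half_open_supp nz).
  by rewrite yE lexx andbT ltr_int ltzD1.
Qed.

Lemma has_integralC f h v :
  has_integral (fun x => f x * h x) v -> has_integral (fun x => h x * f x) v.
Proof. by apply: eq_has_integral => // x; rewrite mulrC. Qed.

(** The bound on k keeps the support inside (0,1], where the father function is 1. *)
Lemma haar_phi_orthogonal j k : (k < 2 ^ j)%N -> has_integral
  (fun x => haar_half_open (Negz 0, Posz 0) x * haar_half_open (Posz j, Posz k) x) 0.
Proof.
move=> kj; apply: (eq_has_integral _ erefl (has_integral_haar j (Posz k))) => x.
have [->|nz] := eqVneq (haar_half_open (Posz j, Posz k) x) 0; first by rewrite mulr0.
have /andP[h1 h2] := haar_half_open_supp nz.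
rewrite /haar_half_open/= subr0 /phi_half_open.
have p0 := pow2_gt0 j.
have -> : x <= 0 = false.
  apply/negP => x0; have : 2 ^+ j * x <= 0 by rewrite pmulr_rle0.
  by apply/negP; rewrite -ltNge (le_lt_trans _ h1).
rewrite ifT ?mul1r// -(ler_pM2l p0) mulr1 (le_trans h2)//.
by rewrite intrD -[_ + 1]/(k%:R + 1) natr1 -natrX ler_nat.
Qed.

Lemma haar_orthonormal J l l' : l \in haar_index J -> l' \in haar_index J ->
  has_integral (fun x => haar_half_open l x * haar_half_open l' x) (l == l')%:R.
Proof.
move=> /mem_haar_index[->|[j [k [-> _ kj]]]] /mem_haar_index[->|[j' [k' [-> _ kj']]]].
- by rewrite eqxx; exact: has_integral_phi_sqr.
- exact: haar_phi_orthogonal.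
- by apply: has_integralC; exact: haar_phi_orthogonal.
have [jj'|jj'|<-] := ltngtP j j'.
- rewrite (_ : (_ == _) = false); last by apply/eqP => -[]; lia.
  rewrite (_ : j' = j + (j' - j).-1.+1)%N; last by lia.
  exact: haar_finer_orthogonal.
- rewrite (_ : (_ == _) = false); last by apply/eqP => -[]; lia.
  rewrite (_ : j = j' + (j - j').-1.+1)%N; last by lia.
  apply: has_integralC; exact: haar_finer_orthogonal.
have [->|kk'] := eqVneq k k'; first by rewrite eqxx; exact: has_integral_haar_sqr.
rewrite (_ : (_ == _) = false); last by apply/eqP => -[] /eqP; rewrite (negPf kk').
(* Distinct translates of one level have disjoint supports: the product is identically zero. *)
apply: (eq_has_integral _ _ (has_integralZ 0 (has_integral_haar j (Posz k))));
  last by rewrite mul0r.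
move=> x; rewrite mul0r; apply/esym/eqP; rewrite mulf_eq0; apply/negPn/negP.
rewrite negb_or => /andP[/haar_half_open_supp /andP[a1 a2] /haar_half_open_supp /andP[b1 b2]].
have := lt_le_trans a1 b2; have := lt_le_trans b1 a2; rewrite !ltr_int.
by move: kk' => /eqP; lia.
Qed.

(** The square is expanded into a double sum and integrated term by term; only the diagonal
    survives. *)
Lemma haar_parseval J (c : int * int -> R) :
  has_integral (fun x => (\sum_(l <- haar_index J) c l * haar_half_open l x) ^+ 2)
    (\sum_(l <- haar_index J) c l ^+ 2).
Proof.
set S := haar_index J.
apply: (eq_has_integral (f := fun x => \sum_(l <- S) \sum_(l' <- S)
    c l * c l' * (haar_half_open l x * haar_half_open l' x))
  (u := \sum_(l <- S) \sum_(l' <- S) c l * c l' * (l == l')%:R)); last first.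
- apply: has_integral_sum => l lS; apply: has_integral_sum => l' lS'.
  by apply: has_integralZ; exact: haar_orthonormal lS lS'.
- rewrite big_seq [RHS]big_seq; apply: eq_bigr => l lS.
  rewrite (bigD1_seq l lS (haar_index_uniq J))/= eqxx mulr1 -expr2 big1 ?addr0//.
  by move=> l' l'l; rewrite eq_sym (negPf l'l) mulr0.
- move=> x; rewrite expr2 mulr_suml; apply: eq_bigr => l _.
  rewrite mulr_sumr; apply: eq_bigr => l' _; ring.
Qed.

(* No measurability is required: the integral of a nonnegative function is a
   supremum over the simple functions below it. *)
Lemma integral_mono (d : measure_display) (T : measurableType d)
    (P : {measure set T -> \bar R}) (f h : T -> \bar R) :
  (forall x : T, 0 <= f x)%E -> (forall x : T, f x <= h x)%E ->
  (\int[P]_x f x <= \int[P]_x h x)%E.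
Proof.
move=> f0 fh.
have h0 (x : T) : (0 <= h x)%E by apply: le_trans (fh x).
rewrite !ge0_integralTE//.
apply: ereal_sup_le => _ [g /= gf <-].
by exists g => // x; exact: le_trans (gf x) (fh x).
Qed.

(** * Lower bound of the loss by the coefficients kept at one level *)

Definition kept_coef (gamma : R) n (pts : seq R) l : R :=
  if eta gamma n pts l <= `|beta_hat n pts l| then beta_hat n pts l else 0.

Lemma f_tilde_HE gamma n pts x : (forall q : rat, x != ratr q) -> 0 < x < 1 ->
  f_tilde_H gamma n pts x =
  \sum_(l <- haar_index (trunc_log 2 n).+1) kept_coef gamma n pts l * haar_half_open l x.
Proof.
move=> xq /andP[x0 x1]; rewrite /f_tilde_H (fsbigE (haar_index (trunc_log 2 n).+1)).
- rewrite big_seq_cond [RHS]big_seq; apply: eq_big => [l|l _].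
    case lS: (l \in _) => //=; apply/mem_set.
    case: (mem_haar_index lS) => [->|[j [k [-> jn _]]]] //=.
  by rewrite haar_half_openE.
- exact: haar_index_uniq.
- move=> l /= /mem_haar_index[->|[j [k [-> jn _]]]]; rewrite /Gamma_n/=; split => //.
(* By contraposition: a Haar function that is non-zero at x in (0,1) has 0 <= k < 2^j, or k = 0 at
   level -1, so its index is in the list. *)
- move=> [j k] [/= j1 j2] lS; apply/eqP; rewrite mulf_eq0; apply/orP; right.
  apply/negPn/negP => nz; move: lS; apply/negP; rewrite negbK.
  move: nz; rewrite -haar_half_openE//.
  case: j j1 j2 => [j|[|j]] // _ j2.
    move=> /haar_half_open_supp/andP[h1 h2].
    have k1 : -1 < k.
      rewrite -(ltr_int R).
      have : 0 < (k + 1)%:~R :> R.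
        by apply: lt_le_trans h2; rewrite mulr_gt0// pow2_gt0.
      rewrite intrD; lra.
    have k2 : k < (2 ^ j)%N.
      rewrite -(ltr_int R); apply: (lt_le_trans h1).
      by rewrite -[leRHS]/((2 ^ j)%:R) natrX ler_piMr ?exprn_ge0// ltW.
    case: k k1 k2 {h1 h2} => [k|k] // _ k2.
    by apply: haar_indexP.
  rewrite /haar_half_open/= /phi_half_open.
  case: (leP (x - k%:~R) 0); rewrite ?eqxx// => h1.
  case: (leP (x - k%:~R) 1); rewrite ?eqxx// => h2 _.
  have k1 : -1 < k by rewrite -(ltr_int R); lra.
  have k2 : k < 1 by rewrite -(ltr_int R); lra.
  by have -> : k = Posz 0 by lia.
Qed.

Lemma countable_rationals : countable [set x : R | exists q : rat, x = ratr q].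
Proof.
apply: card_le_trans (countableP [set: rat]).
apply: card_le_trans (card_image_le (ratr : rat -> R) setT).
by apply: subset_card_le => x [q ->]; exists q.
Qed.

(** The density is itself the basis function of index (-1, 0), so [c] lists the coefficients of the
    error on [0,1]. Parseval gives the sum of their squares, of which only level j is retained;
    there [c] is the kept coefficient. *)
Lemma L2_loss_ge gamma n pts j : (j <= trunc_log 2 n)%N ->
  ((\sum_(0 <= k < 2 ^ j) kept_coef gamma n pts (Posz j, Posz k) ^+ 2)%:E
   <= L2_loss gamma n pts)%E.
Proof.
move=> jn; set J := (trunc_log 2 n).+1.
pose c l := kept_coef gamma n pts l - (l == (Negz 0, Posz 0))%:R.
pose D x := (\sum_(l <- haar_index J) c l * haar_half_open l x) ^+ 2.
have [ci cE] : has_integral D _ := haar_parseval J c.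
apply: (@le_trans _ _ (\sum_(l <- haar_index J) c l ^+ 2)%:E).
  rewrite lee_fin big_cons.
  have jI : j \in iota 0 J by rewrite mem_iota.
  rewrite big_allpairs_dep (bigD1_seq j jI (iota_uniq _ _))/=.
  rewrite addrCA -[leLHS]addr0; apply: lerD; last first.
    rewrite addr_ge0 ?sqr_ge0//; apply: sumr_ge0 => i _; apply: sumr_ge0 => k _; exact: sqr_ge0.
  rewrite /index_iota subn0 le_eqVlt; apply/orP; left; apply/eqP.
  by apply: eq_bigr => k _; rewrite /c subr0.
rewrite -cE.
(* Rationals are removed from the integral of [D], which is integrable; the loss is then only
   compared pointwise. *)
pose Q := [set x : R | exists q : rat, x = ratr q].
have Q0 : mu Q = 0%E by exact/countable_lebesgue_measure0/countable_rationals.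
rewrite (negligible_integral _ _ ci Q0)//; last first.
  by apply: countable_measurable => [t|]; [exact: measurable_set1|exact: countable_rationals].
rewrite integral_mkcond.
apply: integral_mono => x; rewrite patchE; case: ifPn => //.
- by rewrite lee_fin sqr_ge0.
- rewrite in_setD in_setT/= => xQ.
  have xq (q : rat) : x != ratr q.
    by apply/eqP => e; move/negP: xQ; apply; rewrite inE; exists q.
  have [x01|x01] := boolP (0 < x < 1).
    rewrite lee_fin f_tilde_HE// -/J /D; clearbody J.
    rewrite le_eqVlt; apply/orP; left; apply/eqP; congr (_ ^+ 2).
    rewrite /haar_index !big_cons addrAC; congr (_ + _).
      rewrite /c eqxx mulrBl mul1r; congr (_ - _).
      by rewrite haar_half_openE// /haar/= subr0.
    rewrite big_seq [RHS]big_seq; apply: eq_bigr => l /allpairsPdep[a [b [_ _ ->]]].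
    by rewrite /c subr0.
  (* Off (0,1) every listed function vanishes at irrational points, whereas the loss integrand is a
     square. *)
  rewrite lee_fin (_ : D x = 0) ?sqr_ge0// /D big_seq big1 ?expr0n//.
  move=> l /mem_haar_index[->|[a [b [-> _ ba]]]].
    rewrite haar_half_openE// /haar/= subr0 /haar_phi.
    have := xq 0; have := xq 1; rewrite rmorph0 rmorph1 => n1 n0.
    move: x01; rewrite !lt_neqAle eq_sym n0 n1/= => /negPf ->.
    by rewrite mulr0.
  have [->|nz] := eqVneq (haar_half_open (Posz a, Posz b) x) 0; first by rewrite mulr0.
  exfalso; have /andP[h1 h2] := haar_half_open_supp nz.
  have p0 := pow2_gt0 a.
  move/negP: x01; apply; apply/andP; split.
    by rewrite -(pmulr_rgt0 _ p0) (le_lt_trans _ h1).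
  rewrite lt_neqAle; have := xq 1; rewrite rmorph1 => ->/=.
  rewrite -(ler_pM2l p0) mulr1 (le_trans h2)//.
  by rewrite intrD -[_ + 1]/(b%:R + 1) natr1 -natrX ler_nat.
- by rewrite lee_fin sqr_ge0.
Qed.

End HaarSystem.

(** * Empirical coefficients and thresholds in terms of counts *)

Section HaarCoefficients.
Variable R : realType.
Implicit Types (gamma x t : R) (pts : seq R) (n j k a b : nat).

(** The endpoint conventions here and in [haar_right] are those of [haar_psi], so that counts
    determine the empirical coefficients of every configuration, not just almost surely. *)
Definition haar_left j k : set R :=
  `[k%:R / 2 ^+ j, (k%:R + 2^-1) / 2 ^+ j]%classic.

Definition haar_right j k : set R :=
  `](k%:R + 2^-1) / 2 ^+ j, (k%:R + 1) / 2 ^+ j]%classic.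

Lemma haar_indic j k t : haar (Posz j, Posz k) t =
  Num.sqrt (2 ^+ j) * ((t \in haar_left j k)%:R - (t \in haar_right j k)%:R).
Proof.
rewrite /haar/=; congr (_ * _).
rewrite /haar_left /haar_right !mem_setE !in_itv/=.
have p0 := pow2_gt0 R j.
rewrite ler_pdivrMr// ler_pdivlMr// ltr_pdivrMr// ler_pdivlMr// ![t * _]mulrC.
rewrite -[k%:~R]/(k%:R) /haar_psi.
rewrite subr_ge0 !lerBlDl ltrBrDl.
move: (2 ^+ j * t) => z.
case: (leP k%:R z) => ?; case: (leP z (k%:R + 2^-1)) => ?;
  case: (leP z (k%:R + 1)) => ? //=; rewrite ?subr0 ?sub0r ?oppr0//; lra.
Qed.

Lemma haar_left_right_disjoint j k t :
  t \in haar_left j k -> t \in haar_right j k -> False.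
Proof.
rewrite /haar_left /haar_right !mem_setE !in_itv/= => /andP[_ h1] /andP[h2 _].
by have := le_lt_trans h1 h2; rewrite ltxx.
Qed.

Lemma sum_mem_count (A : set R) pts :
  \sum_(t <- pts) (t \in A)%:R = (count_in A pts)%:R :> R.
Proof.
elim: pts => [|t pts IH]; first by rewrite big_nil.
by rewrite big_cons IH /count_in/= natrD.
Qed.

Lemma supnorm_haar j k : supnorm (haar (R := R) (Posz j, Posz k)) = Num.sqrt (2 ^+ j).
Proof.
have ub : ubound (range (fun x : R => `|haar (Posz j, Posz k) x|)) (Num.sqrt (2 ^+ j)).
  move=> _ [x _ <-]; rewrite haar_indic normrM ger0_norm ?sqrtr_ge0//.
  rewrite ler_piMr ?sqrtr_ge0//.
  by case: (_ \in _); case: (_ \in _); rewrite ?subrr ?subr0 ?sub0r ?normrN ?normr0 ?normr1.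
apply/eqP; rewrite eq_le; apply/andP; split.
  by apply: ge_sup => //; exists `|haar (Posz j, Posz k) (0 : R)|, 0.
apply: ub_le_sup; first by exists (Num.sqrt (2 ^+ j)).
exists (k%:R / 2 ^+ j) => //.
rewrite haar_indic /haar_left /haar_right !mem_setE !in_itv/= lexx/=.
have p0 : 0 < (2 ^+ j)^-1 :> R by rewrite invr_gt0 pow2_gt0.
have -> : k%:R / 2 ^+ j <= (k%:R + 2^-1) / 2 ^+ j :> R by rewrite ler_pM2r//; lra.
have -> : ((k%:R + 2^-1) / 2 ^+ j < k%:R / 2 ^+ j :> R) = false.
  by rewrite ltr_pM2r//; apply/negP; lra.
by rewrite subr0 mulr1 ger0_norm ?sqrtr_ge0.
Qed.

Section Counts.
Variables (gamma : R) (n j k a b : nat) (pts : seq R).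
Hypothesis n0 : (0 < n)%N.
Hypothesis countL : count_in (haar_left j k) pts = a.
Hypothesis countR : count_in (haar_right j k) pts = b.
Let l : int * int := (Posz j, Posz k).
Let q : R := Num.sqrt (2 ^+ j) / n%:R.
Let S : R := a%:R + b%:R.

Let q0 : 0 <= q. Proof. by rewrite divr_ge0 ?sqrtr_ge0. Qed.

Lemma beta_hat_counts : beta_hat n pts l = q * (a%:R - b%:R).
Proof.
rewrite /beta_hat; under eq_bigr do rewrite haar_indic.
rewrite -mulr_sumr sumrB !sum_mem_count countL countR.
by rewrite mulrA [_^-1 * _]mulrC.
Qed.

Lemma V_hat_counts : V_hat n pts l = q ^+ 2 * S.
Proof.
rewrite /V_hat (eq_bigr (fun t => Num.sqrt (2 ^+ j) ^+ 2 *
  ((t \in haar_left j k)%:R + (t \in haar_right j k)%:R))); last first.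
  move=> t _; rewrite haar_indic exprMn; congr (_ * _).
  have := @haar_left_right_disjoint j k t.
  case: (t \in haar_left j k); case: (t \in haar_right j k) => //.
  - by move=> /(_ isT isT).
  - by rewrite subr0 addr0 expr1n.
  - by rewrite sub0r add0r sqrrN expr1n.
  - by rewrite subr0 addr0 expr0n.
rewrite -mulr_sumr big_split/= !sum_mem_count countL countR.
by rewrite mulrA [_^-1 * _]mulrC expr_div_n.
Qed.

(** [V_tilde] is homogeneous of degree 2 in q = 2^(j/2) / n, hence the threshold of degree 1, like
    the coefficient: the test becomes one on counts alone. *)
Lemma eta_counts : eta gamma n pts l = q *
  (Num.sqrt (2 * gamma * (S + Num.sqrt (2 * gamma * ln n%:R * S)
     + 3 * gamma * ln n%:R) * ln n%:R) + gamma * ln n%:R / 3).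
Proof.
have n0' : n%:R != 0 :> R by rewrite pnatr_eq0 -lt0n.
rewrite /eta /V_tilde V_hat_counts supnorm_haar.
have -> : Num.sqrt (2 ^+ j) ^+ 2 / n%:R ^+ 2 = q ^+ 2 by rewrite expr_div_n.
have -> : 2 * gamma * ln n%:R * (q ^+ 2 * S) * q ^+ 2
   = (q ^+ 2) ^+ 2 * (2 * gamma * ln n%:R * S) by ring.
have -> : Num.sqrt ((q ^+ 2) ^+ 2 * (2 * gamma * ln n%:R * S))
   = q ^+ 2 * Num.sqrt (2 * gamma * ln n%:R * S).
  by rewrite sqrtrM ?sqr_ge0// sqrtr_sqr (ger0_norm (sqr_ge0 _)).
have -> : forall u, 2 * gamma * (q ^+ 2 * S + q ^+ 2 * u
    + 3 * gamma * ln n%:R * q ^+ 2) * ln n%:R =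
    q ^+ 2 * (2 * gamma * (S + u + 3 * gamma * ln n%:R) * ln n%:R) by move=> u; ring.
rewrite sqrtrM ?sqr_ge0// sqrtr_sqr (ger0_norm q0) [RHS]mulrDr; congr (_ + _).
by rewrite /q; field.
Qed.

(** The common factor q cancels from the test; the kept value q (a - b) is then at least q. *)
Lemma kept_coef_counts :
  Num.sqrt (2 * gamma * (S + Num.sqrt (2 * gamma * ln n%:R * S)
     + 3 * gamma * ln n%:R) * ln n%:R) + gamma * ln n%:R / 3 <= a%:R - b%:R ->
  1 <= a%:R - b%:R :> R ->
  2 ^+ j / n%:R ^+ 2 <= kept_coef gamma n pts l ^+ 2.
Proof.
move=> h ab1; rewrite /kept_coef eta_counts beta_hat_counts.
have ab0 : 0 <= a%:R - b%:R :> R by apply: le_trans ab1.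
rewrite ger0_norm ?mulr_ge0// ler_wpM2l// exprMn.
rewrite /q expr_div_n sqr_sqrtr ?exprn_ge0//; apply: ler_peMr.
  by rewrite divr_ge0 ?exprn_ge0.
by rewrite exprn_ege1.
Qed.

End Counts.
End HaarCoefficients.

(** * Expected loss under the Poisson process *)

Section ExpectedLoss.
Variables (R : realType) (d : measure_display) (T : measurableType d).
Variables (P : probability T R) (N : T -> seq R).

Definition count_event (A B : set R) (a b : nat) : set T :=
  [set w | count_in A (N w) = a] `&` [set w | count_in B (N w) = b].

Lemma poisson_process_pair (h : R -> R) (A B : set R) (a b : nat) (mu : R) :
  poisson_process P h N -> measurable A -> measurable B -> A `&` B = set0 ->
  (\int[lebesgue_measure]_(x in A) (h x)%:E = mu%:E)%E ->
  (\int[lebesgue_measure]_(x in B) (h x)%:E = mu%:E)%E ->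
  P (count_event A B a b) =
  ((expR (- mu) * mu ^+ a / (a`!)%:R) * (expR (- mu) * mu ^+ b / (b`!)%:R))%:E.
Proof.
move=> [mN [PN indep]] mA mB AB0 muA muB.
pose F (i : 'I_2) := if val i == 0%N then A else B.
pose c (i : 'I_2) := if val i == 0%N then a else b.
have := indep 2%N F c.
have -> : \bigcap_(i in [set: 'I_2]) [set w | count_in (F i) (N w) = c i]
   = count_event A B a b.
  apply/seteqP; split => w.
    by move=> h2; split; [exact: (h2 ord0)|exact: (h2 (lift ord0 ord0))].
  by move=> [h1 h2] i _; rewrite /F/c/=; case: ifP.
rewrite big_ord_recl big_ord1 /F /c /= !PN// muA muB /=.
move=> <-.
- by rewrite fineK// fin_num_measure//; apply: measurableI; exact: mN.
- by move=> i; case: ifP.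
- move=> i i'; case: i i' => -[|[|i]] // hi [[|[|i']]] // hi' //= _.
  by rewrite setIC.
Qed.

(** The Boolean endpoints serve the closed left half and the half-open right half together. *)
Lemma intensity_itv (n : nat) (b0 b1 : bool) (u v : R) : 0 <= u -> u <= v -> v <= 1 ->
  (\int[lebesgue_measure]_(x in [set` Interval (BSide b0 u) (BSide b1 v)])
     (n%:R * haar_phi x)%:E = (n%:R * (v - u))%:E)%E.
Proof.
move=> u0 uv v1.
rewrite (eq_integral (cst (n%:R%:E))); last first.
  move=> x; rewrite inE/= => xI.
  have /andP[ux xv] : (u <= x) && (x <= v).
    by move: xI; rewrite itv_boundlr => /andP[/lteifW -> /lteifW ->].
  by rewrite /haar_phi (le_trans u0 ux) (le_trans xv v1) mulr1.
rewrite integral_cst//= EFinM; congr (_ * _)%E.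
rewrite lebesgue_measure_itv/= lte_fin.
by case: ltP => // vu; rewrite (le_anti (introT andP (conj uv vu))) subrr.
Qed.

Lemma haar_pair_prob (n j k a b : nat) : (k < 2 ^ j)%N ->
  poisson_process P (fun x => n%:R * haar_phi x) N ->
  let mu := n%:R / 2 ^+ j.+1 in
  P (count_event (haar_left j k) (haar_right j k) a b) =
  ((expR (- mu) * mu ^+ a / (a`!)%:R) * (expR (- mu) * mu ^+ b / (b`!)%:R))%:E.
Proof.
move=> kj PN mu.
have p0 := pow2_gt0 R j.
have k1 : (k%:R + 1) / 2 ^+ j <= 1 :> R.
  by rewrite ler_pdivrMr// mul1r natr1 -natrX ler_nat.
have k2 : (k%:R + 2^-1) / 2 ^+ j <= (k%:R + 1) / 2 ^+ j :> R.
  by rewrite ler_wpM2r ?invr_ge0 ?exprn_ge0//; lra.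
have k3 : k%:R / 2 ^+ j <= (k%:R + 2^-1) / 2 ^+ j :> R.
  by rewrite ler_wpM2r ?invr_ge0 ?exprn_ge0//; lra.
have k4 : 0 <= k%:R / 2 ^+ j :> R by rewrite divr_ge0 ?exprn_ge0.
apply: (poisson_process_pair a b PN).
- exact: measurable_itv.
- exact: measurable_itv.
- apply/seteqP; split => t //= [/mem_set h1 /mem_set h2].
  exact: haar_left_right_disjoint h1 h2.
- rewrite /haar_left intensity_itv// ?(le_trans k2)//.
  by congr (_%:E); rewrite /mu exprS; field; rewrite gt_eqF.
- rewrite /haar_right intensity_itv// ?(le_trans k4)//.
  by congr (_%:E); rewrite /mu exprS; field; rewrite gt_eqF.
Qed.

(** Each k whose halves hold a and b points adds at least 2^j / n^2 to the loss. There are 2^j such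
    k, each with probability at least p, which gives 2^j (2^j / n^2) p by linearity. *)
Lemma expected_loss_ge (gamma : R) (n j a b : nat) (p : R) :
  (0 < n)%N -> (j <= trunc_log 2 n)%N ->
  poisson_process P (fun x => n%:R * haar_phi x) N ->
  let S : R := a%:R + b%:R in
  Num.sqrt (2 * gamma * (S + Num.sqrt (2 * gamma * ln n%:R * S)
     + 3 * gamma * ln n%:R) * ln n%:R) + gamma * ln n%:R / 3 <= a%:R - b%:R ->
  1 <= a%:R - b%:R :> R ->
  let mu := n%:R / 2 ^+ j.+1 in
  p <= (expR (- mu) * mu ^+ a / (a`!)%:R) * (expR (- mu) * mu ^+ b / (b`!)%:R) ->
  (((2 ^+ j / n%:R) ^+ 2 * p)%:E <= \int[P]_w L2_loss gamma n (N w))%E.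
Proof.
move=> n0 jn PN S hthr ab1 mu hp.
pose E k := count_event (haar_left j k) (haar_right j k) a b.
have mE k : measurable (E k).
  by case: PN => mN _; apply: measurableI; apply: mN; exact: measurable_itv.
pose q : R := 2 ^+ j / n%:R ^+ 2.
have q0 : 0 <= q by rewrite divr_ge0 ?exprn_ge0.
apply: (@le_trans _ _ (\int[P]_w (\sum_(0 <= k < 2 ^ j) (q%:E * (\1_(E k) w)%:E)))%E); last first.
  apply: integral_mono => w.
    by apply: sume_ge0 => k _; rewrite mule_ge0 ?lee_fin.
  apply: le_trans (L2_loss_ge gamma (N w) jn).
  under eq_bigr do rewrite -EFinM.
  rewrite sumEFin lee_fin; apply: ler_sum => k _.
  rewrite indicE; case: (boolP (w \in E k)) => [/set_mem[/= wl wr]|_].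
    by rewrite mulr1; exact: kept_coef_counts wl wr hthr ab1.
  by rewrite mulr0 sqr_ge0.
rewrite ge0_integral_sum//; first last.
- by move=> k w _; rewrite mule_ge0 ?lee_fin.
- move=> k; apply: measurable_funeM; apply/measurable_EFinP.
  exact: measurable_indic.
rewrite (eq_bigr (fun k => q%:E * P (E k))%E); last first.
  move=> k _; rewrite ge0_integralZl_EFin//.
  - by rewrite integral_indic// setIT.
  - by apply/measurable_EFinP; exact: measurable_indic.
apply: (@le_trans _ _ (\sum_(0 <= k < 2 ^ j) (q * p)%:E)%E).
  rewrite sumEFin sumr_const_nat subn0 lee_fin -[leRHS]mulr_natr natrX /q.
  rewrite le_eqVlt; apply/orP; left; apply/eqP; field.
  by rewrite pnatr_eq0 -lt0n.
rewrite [leLHS]big_nat [leRHS]big_nat; apply: lee_sum => k /andP[_ kj].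
rewrite /E (haar_pair_prob a b kj PN) -EFinM lee_fin.
by rewrite ler_wpM2l.
Qed.

End ExpectedLoss.

(** * Choice of the level and the final rate *)

Lemma mean_count_bounds (R : realType) (n K : nat) : (0 < K)%N -> (2 * K <= n)%N ->
  let j := trunc_log 2 (n %/ (2 * K)) in
  (K%:R <= n%:R / 2 ^+ j.+1 :> R) /\ (n%:R / 2 ^+ j.+1 < 2 * K%:R :> R).
Proof.
move=> K0 Kn j.
have K20 : (0 < 2 * K)%N by rewrite muln_gt0.
have d0 : (0 < n %/ (2 * K))%N by rewrite divn_gt0.
(* [j] is the finest level whose halves hold at least K points on average; failure of the next level
   gives the upper bound 2K. *)
have /andP[j1 j2] := trunc_log_bounds (isT : (1 < 2)%N) d0.
rewrite -/j in j1 j2.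
split.
  rewrite ler_pdivlMr ?pow2_gt0// -natrX -natrM ler_nat expnS.
  rewrite mulnCA mulnA (leq_trans (leq_mul (leqnn _) j1))//.
  by rewrite mulnC leq_divM.
rewrite ltr_pdivrMr ?pow2_gt0// -natrX -!natrM ltr_nat.
by rewrite mulnC -ltn_divLR.
Qed.

Lemma inv_twice_mean_count (R : realType) (n j : nat) : 0 < n%:R :> R ->
  2 ^+ j / n%:R = (2 * (n%:R / 2 ^+ j.+1))^-1 :> R.
Proof.
move: (n%:R : R) => y y0; rewrite exprS; field.
by rewrite !gt_eqF// pow2_gt0.
Qed.

(** The denominators (2 mu)^2 and M^2 amount to at most 4 mu^4 <= 4 B^4 n^th, with L = ln n; this
    explains the quarter in the bound on mu. Half of the margin 2 th in the exponent pays for it. *)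
Lemma polynomial_rate_le (R : realType) (B L M mu th e : R) :
  0 < B -> 0 < M -> M <= mu -> mu <= B * expR (th * L / 4) ->
  e <= (1 - 2 * th) * L ->
  expR (- 4) / (4 * B ^+ 4) / expR ((1 - th) * L) <=
  (2 * mu)^-1 ^+ 2 * (expR (- 4) / M ^+ 2 * expR (- e)).
Proof.
move=> B0 M0 Mmu muB eL.
have mu0 : 0 < mu by apply: lt_le_trans Mmu.
have c4 : 0 <= expR (- 4) / 4 :> R by rewrite divr_ge0 ?expR_ge0.
apply: (@le_trans _ _ (expR (- 4) / 4 * (mu ^+ 4)^-1 * expR (- ((1 - 2 * th) * L)))).
  have muB4 : mu ^+ 4 <= B ^+ 4 * expR (th * L).
    have -> : expR (th * L) = expR (th * L / 4) ^+ 4.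
      by rewrite -expRM_natl; congr (expR _); field.
    by rewrite -exprMn; apply: lerXn2r;
      rewrite ?nnegrE ?mulr_ge0 ?expR_ge0 ?(ltW B0) ?(ltW mu0).
  have : (B ^+ 4 * expR (th * L))^-1 <= (mu ^+ 4)^-1.
    by rewrite lef_pV2// posrE ?mulr_gt0 ?exprn_gt0 ?expR_gt0.
  have e4 : 0 <= expR (- 4) / 4 * expR (- ((1 - 2 * th) * L)) :> R.
    by rewrite !mulr_ge0 ?expR_ge0.
  move=> /(ler_wpM2l e4); rewrite [leRHS]mulrAC; apply: le_trans.
  rewrite -expRN.
  have -> : - ((1 - th) * L) = - (th * L) + - ((1 - 2 * th) * L) by ring.
  rewrite expRD [in leRHS]invfM -[in leRHS]expRN.
  rewrite le_eqVlt; apply/orP; left; apply/eqP.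
  move: (expR _) (expR _) (expR _) => x y z; field.
  by rewrite gt_eqF.
have -> : (2 * mu)^-1 ^+ 2 * (expR (- 4) / M ^+ 2 * expR (- e)) =
   expR (- 4) / 4 * ((mu ^+ 2)^-1 * (M ^+ 2)^-1) * expR (- e).
  move: (expR _) (expR _) => x y; field.
  by rewrite !gt_eqF.
apply: ler_pM; rewrite ?expR_ge0 ?mulr_ge0 ?invr_ge0 ?exprn_ge0 ?(ltW mu0)//.
  rewrite ler_wpM2l// -invfM lef_pV2 ?posrE ?mulr_gt0 ?exprn_gt0//.
  rewrite (exprD mu 2 2) ler_wpM2l ?exprn_ge0 ?(ltW mu0)//.
  by apply: lerXn2r; rewrite ?nnegrE ?(ltW M0) ?(ltW mu0).
by rewrite ler_expR lerN2.
Qed.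

Theorem theorem3 (R : realType) (gamma : R) :
  0 < gamma -> gamma < 1 ->
  exists (delta c : R), delta < 1 /\ 0 < c /\
  exists n0 : nat, forall n : nat, (n0 <= n)%N ->
    forall (d : measure_display) (T : measurableType d)
           (P : probability T R) (N : T -> seq R),
      poisson_process P (fun x => n%:R * haar_phi x) N ->
      ((c / (n%:R `^ delta))%:E <= \int[P]_w L2_loss gamma n (N w))%E.
Proof.
move=> gamma0 gamma1.
pose g : R := Num.sqrt gamma.
have g0 : 0 <= g by exact: sqrtr_ge0.
have gE : g ^+ 2 = gamma by rewrite sqr_sqrtr// ltW.
have g1 : g < 1 by rewrite -[ltRHS]sqrtr1 ltr_sqrt.
pose th := (1 - g) / 4.
have th0 : 0 < th by rewrite divr_gt0// subr_gt0.
have gth : g + 4 * th = 1 by rewrite /th; field.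
pose eps := th ^+ 2 / 10.
have eps0 : 0 < eps by rewrite divr_gt0// exprn_gt0.
(* With this [C], the separation L <= eps^2 m reads C L <= m. *)
pose C := (eps ^+ 2)^-1.
have C0 : 0 < C by rewrite invr_gt0 exprn_gt0.
(* Combines 2K <= 2 (C + 2) L with L <= (4 / th) exp (th L / 4). *)
pose B := 2 * (C + 2) * (4 / th).
have C20 : 0 < C + 2 by rewrite addr_gt0.
have B0 : 0 < B by apply: mulr_gt0; [exact: mulr_gt0|exact: divr_gt0].
exists (1 - th), (expR (- 4) / (4 * B ^+ 4)); split; first by rewrite gtrBl.
split; first by rewrite divr_gt0 ?expR_gt0// mulr_gt0// exprn_gt0.
(* The first summand ensures ln n >= 1, the second 4 (C + 2) <= sqrt n, whence 2K <= n. *)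
exists ((Num.trunc (expR 1 : R)).+1 + (Num.trunc ((4 * (C + 2)) ^+ 2)).+1)%N.
move=> n nlarge d T P N PN.
have le_trunc (y : R) : 0 <= y -> ((Num.trunc y).+1 <= n)%N -> y <= n%:R.
  move=> y0 yn; have /andP[_ /ltW h] := truncn_itv y0.
  by rewrite (le_trans h)// ler_nat.
have n_e : expR 1 <= n%:R :> R.
  by apply: le_trunc (expR_ge0 _) (leq_trans _ nlarge); rewrite leq_addr.
have n_C : (4 * (C + 2)) ^+ 2 <= n%:R :> R.
  by apply: le_trunc (sqr_ge0 _) (leq_trans _ nlarge); rewrite leq_addl.
have n0 : 0 < n%:R :> R by apply: lt_le_trans n_e; rewrite expR_gt0.
pose L : R := ln n%:R.
have nE : n%:R = expR L by rewrite lnK ?posrE.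
have L1 : 1 <= L by rewrite -ler_expR -nE.
have L0 : 0 < L by apply: lt_le_trans L1.
(* One unit above what exceeds C L, so that the integer part m of a mean mu >= K is still at least C
   L. *)
pose K := (Num.trunc (C * L)).+2.
have CL0 : 0 <= C * L by rewrite mulr_ge0// ltW.
have /andP[K1 K2] := truncn_itv CL0.
have K_ge : C * L + 1 <= K%:R.
  by rewrite /K -natr1 lerD2r ltW.
have K_le : K%:R <= (C + 2) * L.
  rewrite /K -2!natr1 mulrDl; lra.
have Kn : (2 * K <= n)%N.
  rewrite -(ler_nat R) natrM.
  have e2 : (expR (L / 2)) ^+ 2 = n%:R.
    by rewrite -expRM_natl nE; congr (expR _); field.
  have e1 : 4 * (C + 2) <= expR (L / 2).
    rewrite -(ler_pXn2r (n := 2))// ?nnegrE ?expR_ge0 ?e2//.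
    by rewrite mulr_ge0// addr_ge0// ltW.
  have e3 : L <= 2 * expR (L / 2) by have := expR_ge1Dx (L / 2); lra.
  rewrite -e2 expr2.
  apply: (le_trans (ler_wpM2l _ K_le)) => //.
  apply: (@le_trans _ _ (2 * ((C + 2) * (2 * expR (L / 2))))).
    by rewrite ler_pM2l// ler_pM2l.
  rewrite (_ : _ * _ = 4 * (C + 2) * expR (L / 2)); last by ring.
  by rewrite ler_wpM2r ?expR_ge0.
pose j := trunc_log 2 (n %/ (2 * K)).
pose mu : R := n%:R / 2 ^+ j.+1.
have [mu_ge mu_lt] := mean_count_bounds R (ltn0Sn _ : (0 < K)%N) Kn.
rewrite -/j -/mu in mu_ge mu_lt.
have mu0 : 0 < mu by apply: lt_le_trans mu_ge; rewrite ltr0n.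
pose m := Num.trunc mu.
have /andP[m_le m_gt] := truncn_itv (ltW mu0); rewrite -/m in m_le m_gt.
have LM : L <= eps ^+ 2 * m%:R.
  have : C * L <= m%:R by move: m_gt; rewrite -natr1; lra.
  by rewrite /C ler_pdivrMl// exprn_gt0.
pose r := Num.sqrt (L * m%:R).
have r0 : 0 <= r by exact: sqrtr_ge0.
have rE : r ^+ 2 = L * m%:R by rewrite sqr_sqrtr// mulr_ge0// ltW.
(* The successor of the integer part makes s strictly larger than (g + th) r, by at most 1. *)
pose s := (Num.trunc ((g + th) * r)).+1.
have gr0 : 0 <= (g + th) * r by rewrite mulr_ge0// addr_ge0// ltW.
have /andP[s1 s2] := truncn_itv gr0; rewrite -/s in s2.
have s_le : s%:R <= (g + th) * r + 1 by rewrite /s -natr1 lerD2r.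
have sM := threshold_deviation_lt g0 th0 gth erefl L1 LM r0 rE s_le.
have s_thr := threshold_deviation_le g0 th0 gth erefl L1 LM r0 rE s2.
have s_exp := threshold_exponent_le g0 th0 gth erefl L1 LM r0 rE s2 s_le.
rewrite ltr_nat in sM.
have m0 : 0 < m%:R :> R by rewrite ltr0n (leq_ltn_trans _ sM).
have Sab : (m + s)%:R + (m - s)%:R = 2 * m%:R :> R.
  by rewrite natrD (natrB _ (ltnW sM)); ring.
have Dab : (m + s)%:R - (m - s)%:R = 2 * s%:R :> R.
  by rewrite natrD (natrB _ (ltnW sM)); ring.
have muB : 2 * K%:R <= B * expR (th * L / 4).
  have e : L <= 4 / th * expR (th * L / 4).
    rewrite mulrAC ler_pdivlMr// mulrC -ler_pdivrMl//.
    apply: le_trans (expR_ge1Dx _); rewrite [leLHS]mulrC lerDr//.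
  apply: (@le_trans _ _ (2 * ((C + 2) * L))); first by rewrite ler_pM2l.
  have -> : B * expR (th * L / 4) = 2 * ((C + 2) * (4 / th * expR (th * L / 4))).
    by rewrite /B !mulrA.
  by rewrite ler_pM2l// ler_pM2l.
have pair := poisson_pair_ge sM m_le m_gt.
apply: le_trans (expected_loss_ge (gamma := gamma) (j := j) (a := m + s) (b := m - s)
   _ _ PN _ _ pair).
- rewrite lee_fin.
  rewrite inv_twice_mean_count// -/mu /powR gt_eqF//.
  by apply: polynomial_rate_le => //; exact: le_trans (ltW mu_lt) muB.
- by rewrite -(ltr0n R).
- by apply: leq_trunc_log; exact: leq_div.
- by rewrite Sab Dab -gE.
- by rewrite Dab -natrM ler1n.
Qed.
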